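(* The sixth Painlevé equation with parameters $k,\mu,s$ $$P_{VI}\left(\frac{k^2}{2},\,-\frac{(\mu+s)^2}{2},\,\frac{(k-s+1)^2}{2},\,\frac{1-\mu^2}{2}\right)$$ has the following solutions. (a) The function $$y=x\left\{1+\frac{\mu(1-x)}{s}\,\frac{F(k+1,1-\mu,s+1,x)}{F(k,-\mu,s,x)}\right\}.$$ It is rational in the following cases: (i) $\mu$ is a positive integer; (ii) $k$ is a negative integer; (iii) $k-s$ is a positive integer; (iv) $\mu+s$ is a negative integer. (b) If $s\notin\mathbb{Z}$ there is a second solution $$y=\frac{x(x-1)}{k}\left\{\frac{1-s}{x}-\frac{k}{1-x}+\frac{(k-s+1)(1-\mu-s)}{2-s}\,\frac{F(k-s+2,2-\mu-s,3-s,x)}{F(k-s+1,1-\mu-s,2-s,x)}\right\}.$$ It is rational in the following cases: (i) $1-\mu-s$ is a negative integer; (ii) $k-s+1$ is a negative integer; (iii) $k$ is a positive integer; (iv) $\mu$ is a negative integer.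
   Context: $P_{VI}(\alpha,\beta,\gamma,\delta)$ denotes the sixth Painlevé equation for a function $y=y(x)$ (prime means $d/dx$): $$y''=\frac12\left(\frac1y+\frac1{y-1}+\frac1{y-x}\right)(y')^2-\left(\frac1x+\frac1{x-1}+\frac1{y-x}\right)y'+\frac{y(y-1)(y-x)}{x^2(x-1)^2}\left\{\alpha+\frac{\beta x}{y^2}+\frac{\gamma(x-1)}{(y-1)^2}+\frac{\delta x(x-1)}{(y-x)^2}\right\}.$$ $F$ is the Gauss hypergeometric function $$F(\alpha,\beta,\gamma,x)=\sum_{n=0}^\infty\frac{(\alpha)_n(\beta)_n}{(\gamma)_n}\frac{x^n}{n!},$$ where $(\alpha)_n=\alpha(\alpha+1)\cdots(\alpha+n-1)$ is the Pochhammer symbol. ''Rational'' means that $y$ is a rational function of $x$. *)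

(* Defs.v *)
From HB Require Import structures.
From mathcomp Require Import all_boot all_order all_algebra.
From mathcomp Require Import complex.
From mathcomp Require Import all_classical all_reals all_analysis.

Set Implicit Arguments.
Unset Strict Implicit.
Unset Printing Implicit Defensive.

Import Order.TTheory GRing.Theory Num.Theory.
Import numFieldNormedType.Exports.

Local Open Scope classical_set_scope.
Local Open Scope ring_scope.

(* The field K is used below with K = R[i], so that derivability in the sense
   of the library is complex differentiability. *)
Section PainleveVI.
Variable K : numFieldType.
Implicit Types (a b c d x k mu s : K) (y : K -> K) (D : set K).

Definition pochhammer a (n : nat) : K := \prod_(i < n) (a + i%:R).

(* Meaningful when the series converges and c is not a nonpositive integer
   (otherwise some coefficients are divisions by zero). *)
Definition hypergeo a b c x : K :=
  limn (series (fun n : nat =>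
    pochhammer a n * pochhammer b n / pochhammer c n * (x ^+ n / n`!%:R))).

(* Right-hand side of P_VI(a, b, c, d) at the values (x, y, y') *)
Definition PVI_rhs a b c d (x y y' : K) : K :=
  1 / 2 * (1 / y + 1 / (y - 1) + 1 / (y - x)) * y' ^+ 2
  - (1 / x + 1 / (x - 1) + 1 / (y - x)) * y'
  + y * (y - 1) * (y - x) / (x ^+ 2 * (x - 1) ^+ 2)
    * (a + b * x / y ^+ 2 + c * (x - 1) / (y - 1) ^+ 2
       + d * x * (x - 1) / (y - x) ^+ 2).

(* The equation is singular where y(x) is 0, 1 or x. *)
Definition PVI_regular y x : Prop := [/\ y x != 0, y x != 1 & y x != x].

(* Meant for an open set D avoiding 0 and 1: y is twice complex differentiable
   throughout D (in particular it has no poles there), and the equation holds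
   at every point of D where its right-hand side is defined. *)
Definition PVI_solution_on D a b c d y : Prop :=
  [/\ forall x, D x -> derivable y x 1,
      forall x, D x -> derivable (derive1 y) x 1 &
      forall x, D x -> PVI_regular y x ->
        derive1 (derive1 y) x = PVI_rhs a b c d x (y x) (derive1 y x)].

(* y is not identically 0, 1 or x, so that the equation is not vacuous along y.
   For the solutions below the exceptional cases are mu = 0 (y1 = x),
   mu + s = 0 (y1 = 0) and k - s + 1 = 0 (y2 = 1). *)
Definition PVI_nondegenerate_on D y : Prop :=
  exists2 x, D x & PVI_regular y x.

Definition rational_on D y : Prop :=
  exists p q : {poly K}, forall x, D x -> q.[x] != 0 /\ y x = p.[x] / q.[x].

(* Unit disc (where the hypergeometric series converge) without the singular
   point 0 of the equation and the zeros of the denominator f *)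
Definition punctured_disc_off (f : K -> K) : set K :=
  [set x | 0 < `|x| < 1 /\ f x != 0].

Definition y1 k mu s x : K :=
  x * (1 + mu * (1 - x) / s
           * (hypergeo (k + 1) (1 - mu) (s + 1) x / hypergeo k (- mu) s x)).

Definition dom1 k mu s : set K := punctured_disc_off (hypergeo k (- mu) s).

Definition y2 k mu s x : K :=
  x * (x - 1) / k
  * ((1 - s) / x - k / (1 - x)
     + (k - s + 1) * (1 - mu - s) / (2 - s)
       * (hypergeo (k - s + 2) (2 - mu - s) (3 - s) x
          / hypergeo (k - s + 1) (1 - mu - s) (2 - s) x)).

Definition dom2 k mu s : set K :=
  punctured_disc_off (hypergeo (k - s + 1) (1 - mu - s) (2 - s)).

Definition positive_integer a : Prop := exists n : nat, a = n.+1%:R.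
Definition negative_integer a : Prop := exists n : nat, a = - n.+1%:R.

End PainleveVI.

(* Main.v *)
(* Each of the two functions solves a Riccati equation
     x (1 - x) y' = k y^2 + (1 - s - (k + mu + 1) x) y + (s + mu) x,
   and every solution of it solves P_VI.  The Riccati equation comes from the
   hypergeometric equation written as a first-order system for F(a, b, c) and
   G = F(a+1, b+1, c+1), an identity between coefficients.

   If a or b is a negative integer, F and G are polynomials.  If c - a or c - b
   is a nonpositive integer, put f = F(c-a, c-b, c) and g = F(c-a, c-b, c+1),
   which are polynomials.  Euler's transformation says that (1 - x) G / F = g / f.
   This relation is obtained without the powers of 1 - x: D = (1 - x) G f - F g
   satisfies x D' = - c D, and no nonzero power series does so when - c is
   not a natural number.

   The analysis is carried out over a numFieldType in which series dominated by
   a geometric one converge, and specialized to R[i] at the end. *)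
Require Import Defs.
From HB Require Import structures.
From mathcomp Require Import all_boot all_order all_algebra.
From mathcomp Require Import complex.
From mathcomp Require Import all_classical all_reals all_analysis.
From mathcomp Require Import ring.
Set Implicit Arguments.
Unset Strict Implicit.
Unset Printing Implicit Defensive.
Import Order.TTheory GRing.Theory Num.Theory.
Import numFieldNormedType.Exports.
Local Open Scope classical_set_scope.
Local Open Scope ring_scope.

(** * Estimates for power series on the open unit disc *)

Section PowerSeries.
Context {K : numFieldType}.
Implicit Types (a b : nat -> K) (x h q r : K).

(** The order of [K] is only partial. [M] is real because it dominates a norm, so it can be compared
    with [|l|]; were [|l|] larger, a term within [|l| - M] of the limit would exceed [M]. *)
Lemma cvgn_norm_le (u : nat -> K) (l M : K) :
  u n @[n --> \oo] --> l -> (forall n, `|u n| <= M) -> `|l| <= M.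
Proof.
move=> ul uM; have M0 : M \is Num.real.
  by apply: ger0_real; apply: le_trans (uM 0%N).
have [//|Ml] := real_leP (normr_real l) M0; exfalso.
have e0 : 0 < `|l| - M by rewrite subr_gt0.
have /cvgrPdist_lt /(_ _ e0) [N _ /(_ N (leqnn N)) /= HN] := ul.
have : `|l| < `|l|.
  have := ler_normD (l - u N) (u N); rewrite subrK => /le_lt_trans; apply.
  by rewrite -[ltRHS](subrK M); apply: ltr_leD.
by rewrite ltxx.
Qed.

Lemma cvgn_unique_lim (u : nat -> K) l : u n @[n --> \oo] --> l -> limn u = l.
Proof. by move=> ?; apply: cvg_lim. Qed.

Lemma seriesS_cvg (u : nat -> K) l :
  series (fun n => u n.+1) n @[n --> \oo] --> l ->
  series u n @[n --> \oo] --> u 0%N + l.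
Proof.
move=> H; rewrite -cvg_shiftS.
have -> : (fun n => series u n.+1) = (fun n => u 0%N + series (fun n => u n.+1) n).
  by apply/funext => n; rewrite /series /= big_nat_recl.
by apply: cvgD => //; apply: cvg_cst.
Qed.

Lemma lim_series_le (u : nat -> K) (C q : K) l :
  0 <= C -> 0 <= q < 1 -> (forall n, `|u n| <= C * q ^+ n) ->
  series u n @[n --> \oo] --> l -> `|l| <= C / (1 - q).
Proof.
move=> C0 /andP[q0 q1] uC ul; apply: (cvgn_norm_le ul) => n.
have p : 0 < 1 - q by rewrite subr_gt0.
apply: le_trans (ler_norm_sum _ _ _) _.
apply: le_trans (ler_sum _ (fun i _ => uC i)) _.
rewrite -mulr_sumr ler_wpM2l // -[leRHS]mul1r ler_pdivlMr //.
rewrite big_mkord mulrC -opprB mulNr -subrX1 opprB lerBlDr lerDl.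
exact: exprn_ge0.
Qed.

(* Sequences whose power series converges on the open unit disc. *)
Definition subgeometric a :=
  forall r, 0 < r < 1 -> exists2 C, 0 <= C & forall n, `|a n| * r ^+ n <= C.

Lemma lt1_between r : 0 <= r < 1 -> exists2 t, 0 < t & r < t < 1.
Proof.
move=> /andP[r0 r1]; exists ((r + 1) / 2).
  by rewrite divr_gt0 ?ltr0n// ltr_wpDl.
by rewrite !midf_lt.
Qed.

(** Induction after multiplying by [1 - q]: the step closes because [q * q + q * (1 - q) = q]. *)
Lemma natr_exp_le q n : 0 <= q < 1 -> n%:R * q ^+ n <= q / (1 - q).
Proof.
move=> /andP[q0 q1]; have p : 0 < 1 - q by rewrite subr_gt0.
rewrite ler_pdivlMr //; elim: n => [|n IH]; first by rewrite !mul0r.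
have qn : q ^+ n <= 1 by rewrite exprn_ile1 // ltW.
have H : (n%:R * q ^+ n * (1 - q)) * q <= q * q by rewrite ler_wpM2r.
have -> : n.+1%:R * q ^+ n.+1 * (1 - q)
   = n%:R * q ^+ n * (1 - q) * q + q * (1 - q) * q ^+ n by rewrite -natr1 exprS; ring.
apply: le_trans (lerD H (ler_wpM2l _ qn)) _; first by rewrite mulr_ge0 // ltW.
by rewrite mulr1 -mulrDr addrC subrK mulr1.
Qed.

Lemma subgeometricD a b : subgeometric a -> subgeometric b ->
  subgeometric (fun n => a n + b n).
Proof.
move=> Ha Hb r r01; have [C C0 HC] := Ha r r01; have [D D0 HD] := Hb r r01.
exists (C + D); first exact: addr_ge0.
move=> n; apply: le_trans (lerD (HC n) (HD n)); rewrite -mulrDl.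
have /andP[/ltW r0 _] := r01.
by rewrite ler_wpM2r ?exprn_ge0 // ler_normD.
Qed.

Lemma subgeometricZ c a : subgeometric a -> subgeometric (fun n => c * a n).
Proof.
move=> Ha r r01; have [C C0 HC] := Ha r r01.
exists (`|c| * C); first exact: mulr_ge0.
by move=> n; rewrite normrM -mulrA ler_wpM2l.
Qed.

(** Some [t < 1] satisfies [r <= t * t], and each factor is bounded at radius [t]. *)
Lemma subgeometricM a b : subgeometric a -> subgeometric b ->
  subgeometric (fun n => a n * b n).
Proof.
move=> Ha Hb r /andP[r0 r1].
have [t t01 rt] : exists2 t, 0 < t < 1 & r <= t * t.
  (* The midpoint of [r] and 1 replaces a square root of [r]: its square exceeds [r] by
     [(1 - r) ^+ 2 / 4]. *)
  exists ((r + 1) / 2).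
    by rewrite divr_gt0 ?ltr0n// ?ltr_wpDl ?ltW // (midf_lt r1).2.
  have -> : (r + 1) / 2 * ((r + 1) / 2) = r + (1 - r) ^+ 2 / 4 by field.
  by rewrite lerDl divr_ge0 ?ler0n // exprn_ge0 // subr_ge0 ltW.
have [C C0 HC] := Ha t t01; have [D D0 HD] := Hb t t01.
exists (C * D); first exact: mulr_ge0.
have /andP[/ltW t0 _] := t01.
move=> n; have p0 (z : K) : 0 <= `|z| * t ^+ n by rewrite mulr_ge0 // exprn_ge0.
apply: le_trans (ler_pM (p0 _) (p0 _) (HC n) (HD n)).
rewrite normrM mulrACA -exprMn ler_wpM2l ?mulr_ge0 //.
apply: lerXn2r => //; rewrite nnegrE ?mulr_ge0 //.
exact: ltW.
Qed.

(** At a radius [t] between [r] and 1, the spare factor [(r / t) ^+ n] absorbs [n]. *)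
Lemma subgeometric_natM a : subgeometric a -> subgeometric (fun n => n%:R * a n).
Proof.
move=> Ha r /andP[r0 r1]; have [|t t0 /andP[rt t1]] := @lt1_between r.
  by rewrite ltW.
have [|C C0 HC] := Ha t; first by rewrite t0.
have q01 : 0 <= r / t < 1 by rewrite divr_ge0 ?ltW //= ltr_pdivrMr // mul1r.
exists (C * (r / t / (1 - r / t))).
  by have /andP[? ?] := q01; rewrite mulr_ge0 // divr_ge0 // subr_ge0 ltW.
move=> n; have -> : `|n%:R * a n| * r ^+ n =
    (`|a n| * t ^+ n) * (n%:R * (r / t) ^+ n).
  rewrite normrM normr_nat expr_div_n; field.
  by rewrite expf_neq0 ?gt_eqF.
apply: ler_pM => //; first by rewrite mulr_ge0 // exprn_ge0 // ltW.
  by rewrite mulr_ge0 // exprn_ge0 //; case/andP: q01.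
exact: natr_exp_le.
Qed.

Lemma subgeometricS a : subgeometric a -> subgeometric (fun n => a n.+1).
Proof.
move=> Ha r r01; have [C C0 HC] := Ha r r01; have /andP[r0 r1] := r01.
exists (C / r); first by rewrite divr_ge0 // ltW.
by move=> n; rewrite ler_pdivlMr // -mulrA -exprSr.
Qed.

Lemma subgeometric_shift a : subgeometric a ->
  subgeometric (fun n => if n is m.+1 then a m else 0).
Proof.
move=> Ha r r01; have [C C0 HC] := Ha r r01; have /andP[r0 r1] := r01.
exists C => // -[|n]; first by rewrite normr0 mul0r.
rewrite exprS mulrCA; apply: le_trans (HC n).
apply: ler_piMl; last exact: ltW.
by rewrite mulr_ge0 // exprn_ge0 // ltW.
Qed.

Lemma is_derive_quadratic (f : K -> K) x l d (M : K) : 0 < d -> 0 <= M ->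
  (forall h, `|h| < d -> `|f (x + h) - f x - h * l| <= M * `|h| ^+ 2) ->
  is_derive x 1 f l.
Proof.
move=> d0 M0 H.
suff : h^-1 *: ((f \o shift x) (h *: 1) - f x) @[h --> 0^'] --> l.
  by move=> cl; apply: DeriveDef; [apply/cvg_ex; exists l; exact: cl | apply: cvg_lim].
apply/cvgrPdist_lt => e e0.
have M1 : 0 < M + 1 by rewrite ltr_wpDl.
near=> h.
have h0 : h != 0 by near: h; exact: nbhs_dnbhs_neq.
have hd : `|h| < d by near: h; exact: dnbhs0_lt.
(* Dividing by [M + 1] rather than [M] covers [M = 0]. *)
have he : `|h| < e / (M + 1) by near: h; apply: dnbhs0_lt; rewrite divr_gt0.
have hp : 0 < `|h| by rewrite normr_gt0.
rewrite -(ltr_pM2l hp) -normrM mulrBr /= mulrA divff // mul1r.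
rewrite -normrN opprB [h *: 1]mulr1 (addrC h).
apply: le_lt_trans (H h hd) _; rewrite expr2 mulrCA ltr_pM2l //.
move: he; rewrite ltr_pdivlMr // mulrDr mulr1 mulrC; apply: le_lt_trans.
by rewrite lerDl.
Unshelve. all: by end_near. Qed.

(** Taylor bound [n ^+ 2 * r ^+ (n - 2) * |h| ^+ 2], with [r ^+ 2] moved to the left so that no
    exponent is negative. The remainders satisfy [E (n + 1) = (x + h) * E n + n * h ^+ 2 * x ^+ (n -
    1)], and [n ^+ 2 + n <= (n + 1) ^+ 2] closes the induction. *)
Lemma expr_remainder_le x h r n : `|x| <= r -> `|x + h| <= r ->
  r ^+ 2 * `|(x + h) ^+ n - x ^+ n - h * (n%:R * x ^+ n.-1)|
    <= (n%:R * (n%:R * r ^+ n)) * `|h| ^+ 2.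
Proof.
move=> xr xhr; have r0 : 0 <= r by apply: le_trans xr.
elim: n => [|n IH]; first by rewrite !expr0 subrr !mul0r mulr0 subrr normr0 mulr0.
have -> : (x + h) ^+ n.+1 - x ^+ n.+1 - h * (n.+1%:R * x ^+ n.+1.-1) =
   (x + h) * ((x + h) ^+ n - x ^+ n - h * (n%:R * x ^+ n.-1))
   + n%:R * (h ^+ 2 * x ^+ n.-1).
  case: n {IH} => [|n] /=; first by rewrite !expr0 !expr1; ring.
  by rewrite -natr1 !exprS; ring.
have H1 : r ^+ 2 * `|(x + h) * ((x + h) ^+ n - x ^+ n - h * (n%:R * x ^+ n.-1))|
   <= r * (n%:R * (n%:R * r ^+ n) * `|h| ^+ 2).
  by rewrite normrM mulrCA ler_pM // mulr_ge0 // exprn_ge0.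
have H2 : r ^+ 2 * `|n%:R * (h ^+ 2 * x ^+ n.-1)| <= n%:R * (`|h| ^+ 2 * r ^+ n.+1).
  case: n {IH H1} => [|n]; first by rewrite !mul0r normr0 mulr0.
  rewrite !normrM normr_nat !normrX [X in X <= _]mulrCA ler_wpM2l // mulrCA.
  by rewrite ler_wpM2l ?exprn_ge0 //= !exprS !mulrA expr0 mulr1 ler_wpM2l ?mulr_ge0 // lerXn2r.
rewrite -natr1; apply: (@le_trans _ _ (r * (n%:R * (n%:R * r ^+ n) * `|h| ^+ 2)
   + n%:R * (`|h| ^+ 2 * r ^+ n.+1))).
  by apply: le_trans (lerD H1 H2); rewrite -mulrDr ler_wpM2l ?exprn_ge0 // ler_normD.
rewrite -subr_ge0.
set y := (X in 0 <= X).
have -> : y = (n%:R + 1) * (r ^+ n.+1 * `|h| ^+ 2) by rewrite /y !exprS; ring.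
by rewrite mulr_ge0 ?addr_ge0 // mulr_ge0 ?exprn_ge0.
Qed.

Definition psum a x : K := limn (series (fun n => a n * x ^+ n)).

Definition geometric_complete : Prop := forall (u : nat -> K) (C q : K),
  0 <= q < 1 -> (forall n, `|u n| <= C * q ^+ n) -> cvgn (series u).

End PowerSeries.
Arguments geometric_complete : clear implicits.

(** * Algebra, termwise differentiation and uniqueness for sums of power series *)

Section PowerSeriesSum.
Context {K : numFieldType} (Kc : geometric_complete K).
Implicit Types (a b : nat -> K) (x h q r : K).

(** For [t] between [|x|] and 1, the terms are dominated by a geometric sequence of ratio
    [|x| / t]. *)
Lemma psum_cvg a x : subgeometric a -> `|x| < 1 ->
  series (fun n => a n * x ^+ n) n @[n --> \oo] --> psum a x.
Proof.
move=> Ha x1; have [|t t0 /andP[xt t1]] := @lt1_between K `|x|.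
  by rewrite normr_ge0.
have [|C C0 HC] := Ha t; first by rewrite t0.
apply: (Kc (C := C) (q := `|x| / t)).
  by rewrite divr_ge0 ?(ltW t0) //= ltr_pdivrMr // mul1r.
move=> n; rewrite normrM normrX expr_div_n -[leLHS]mulr1.
rewrite -(@mulfV _ (t ^+ n)) ?expf_neq0 ?gt_eqF //.
by rewrite mulrACA ler_wpM2r // divr_ge0 ?exprn_ge0 // ltW.
Qed.

Lemma psum_eq a x l : series (fun n => a n * x ^+ n) n @[n --> \oo] --> l ->
  psum a x = l.
Proof. exact: cvgn_unique_lim. Qed.

Lemma psumD a b x : subgeometric a -> subgeometric b -> `|x| < 1 ->
  psum (fun n => a n + b n) x = psum a x + psum b x.
Proof.
move=> Ha Hb x1; apply: psum_eq.
have -> : (fun n => (a n + b n) * x ^+ n) =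
  (fun n => a n * x ^+ n) + (fun n => b n * x ^+ n).
  by apply/funext => n; rewrite mulrDl.
by rewrite seriesD; apply: cvgD; exact: psum_cvg.
Qed.

Lemma psumZ c a x : subgeometric a -> `|x| < 1 ->
  psum (fun n => c * a n) x = c * psum a x.
Proof.
move=> Ha x1; apply: psum_eq.
have -> : series (fun n => c * a n * x ^+ n) =
    (fun n => c * series (fun n => a n * x ^+ n) n).
  by apply/funext => n; rewrite /series /= mulr_sumr; apply: eq_bigr => i _; rewrite mulrA.
by apply: cvgMr; exact: psum_cvg.
Qed.

Lemma psumS a x : subgeometric a -> `|x| < 1 ->
  psum a x = a 0%N + x * psum (fun n => a n.+1) x.
Proof.
move=> Ha x1; apply: psum_eq.
have -> : a 0%N = (fun n => a n * x ^+ n) 0%N by rewrite mulr1.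
apply: seriesS_cvg.
have -> : series (fun n => a n.+1 * x ^+ n.+1) =
    (fun n => x * series (fun n => a n.+1 * x ^+ n) n).
  apply/funext => n; rewrite /series /= mulr_sumr; apply: eq_bigr => i _.
  by rewrite exprS mulrCA.
by apply: cvgMr; apply: psum_cvg => //; exact: subgeometricS.
Qed.

Lemma psum0 a : subgeometric a -> psum a 0 = a 0%N.
Proof. by move=> Ha; rewrite psumS ?normr0 ?ltr01 // mul0r addr0. Qed.

Definition deriv_seq a (n : nat) : K := n.+1%:R * a n.+1.

Lemma subgeometric_deriv a : subgeometric a -> subgeometric (deriv_seq a).
Proof.
by move=> Ha; apply: (@subgeometricS _ (fun n => n%:R * a n)); exact: subgeometric_natM.
Qed.

Lemma psum_natM a x : subgeometric a -> `|x| < 1 ->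
  psum (fun n => n%:R * a n) x = x * psum (deriv_seq a) x.
Proof.
move=> Ha x1; rewrite psumS //; last exact: subgeometric_natM.
by rewrite mul0r add0r.
Qed.

(** With [|x| < r < t < 1], the Taylor remainder of the [n]-th term is at most a constant times
    [|h| ^+ 2 * (r / t) ^+ n], the factor [n ^+ 2] being absorbed at radius [t]. Summing over [n]
    leaves an error quadratic in [h]. *)
Lemma psum_is_derive a x : subgeometric a -> `|x| < 1 ->
  is_derive x 1 (psum a) (psum (deriv_seq a) x).
Proof.
move=> Ha x1; have [|r r0 /andP[xr r1]] := @lt1_between K `|x|.
  by rewrite normr_ge0.
have [|t t0 /andP[rt t1]] := @lt1_between K r; first by rewrite ltW.
have H2 := subgeometric_natM (subgeometric_natM Ha).
have [|C C0 HC] := H2 t; first by rewrite t0.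
have q01 : 0 <= r / t < 1 by rewrite divr_ge0 ?ltW //= ltr_pdivrMr // mul1r.
have q1 : 0 < 1 - r / t by rewrite subr_gt0; case/andP: q01.
apply: (@is_derive_quadratic _ _ _ _ (r - `|x|) (C / r ^+ 2 / (1 - r / t))).
- by rewrite subr_gt0.
- by rewrite divr_ge0 ?(ltW q1) // divr_ge0 // exprn_ge0 // ltW.
move=> h hr.
have xhr : `|x + h| <= r.
  apply: le_trans (ler_normD _ _) _; rewrite -lerBrDl; exact: ltW.
have D : series (fun n => n%:R * a n * x ^+ n.-1) n @[n --> \oo]
   --> psum (deriv_seq a) x.
  (* The term of index 0 is zero and [0.-1 = 0], so this series is the series of [deriv_seq a]
     shifted by one place. *)
  rewrite -[psum _ _]add0r -[X in X + _](mul0r (x ^+ 0%N.-1)) -[X in X * _ + _](mul0r (a 0%N)).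
  apply: seriesS_cvg; apply: psum_cvg => //; exact: subgeometric_deriv.
have xh1 : `|x + h| < 1 by apply: le_lt_trans r1.
have S := cvgB (cvgB (psum_cvg Ha xh1) (psum_cvg Ha x1)) (cvgMr (a := h) D).
rewrite mulrAC.
apply: (@lim_series_le _ (fun n => a n * ((x + h) ^+ n - x ^+ n - h * (n%:R * x ^+ n.-1)))
   _ (r / t) _ _ q01).
- by rewrite mulr_ge0 ?exprn_ge0 // divr_ge0 // exprn_ge0 // ltW.
- move=> n; have E := expr_remainder_le n (ltW xr) xhr.
  have r20 : 0 < r ^+ 2 by rewrite exprn_gt0.
  rewrite -(ler_pM2l r20) normrM mulrCA.
  apply: le_trans (ler_wpM2l (normr_ge0 _) E) _.
  have -> : r ^+ 2 * (C / r ^+ 2 * `|h| ^+ 2 * (r / t) ^+ n) =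
     C * (`|h| ^+ 2 * (r / t) ^+ n).
    by rewrite !mulrA (mulrC _ C) mulfK // gt_eqF.
  have -> : `|a n| * (n%:R * (n%:R * r ^+ n) * `|h| ^+ 2) =
     `|n%:R * (n%:R * a n)| * t ^+ n * (`|h| ^+ 2 * (r / t) ^+ n).
    rewrite !normrM !normr_nat expr_div_n; field.
    by rewrite expf_neq0 ?gt_eqF.
  apply: ler_wpM2r (HC n).
  by rewrite mulr_ge0 ?exprn_ge0 //; case/andP: q01.
- have -> : series (fun n => a n * ((x + h) ^+ n - x ^+ n - h * (n%:R * x ^+ n.-1))) =
    (fun n => series (fun n => a n * (x + h) ^+ n) n - series (fun n => a n * x ^+ n) n
       - h * series (fun n => n%:R * a n * x ^+ n.-1) n).
    apply/funext => n; rewrite /series /= mulr_sumr -!sumrB; apply: eq_bigr => i _.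
    by rewrite !mulrBr; congr (_ - _); ring.
  exact: S.
Qed.

Lemma open_unit_disc x : `|x| < 1 -> \forall y \near x, `|y| < 1.
Proof.
move=> x1; near=> y.
have d : `|x - y| < 1 - `|x| by near: y; apply: cvgr_dist_lt; rewrite ?subr_gt0.
rewrite -[y](subKr x); apply: le_lt_trans (ler_normB _ _) _.
by rewrite addrC -ltrBrDr.
Unshelve. all: by end_near. Qed.

(** Evaluation at 0 kills the first coefficient. The derivative of the sum vanishes on the disc as
    well, so induction applies to [deriv_seq a], and the factor [n + 1] cancels in characteristic
    0. *)
Lemma psum_eq0 a : subgeometric a -> (forall x, `|x| < 1 -> psum a x = 0) ->
  forall n, a n = 0.
Proof.
move=> Ha H n; elim: n a Ha H => [|n IH] a Ha H.
  by rewrite -(psum0 Ha) H ?normr0.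
have /eqP : deriv_seq a n = 0.
  apply: IH => [|x x1]; first exact: subgeometric_deriv.
  have D := psum_is_derive Ha x1.
  have : is_derive x 1 (cst 0 : K -> K) (psum (deriv_seq a) x).
    by apply: near_eq_is_derive D; near=> y; apply: H; near: y; exact: open_unit_disc.
  by move=> E; rewrite -(@derive_val _ _ _ _ _ _ _ E) derive_cst.
by rewrite mulf_eq0 pnatr_eq0 => /eqP.
Unshelve. all: by end_near. Qed.

End PowerSeriesSum.

(** * Recurrences and growth of the hypergeometric coefficients *)

Section Hypergeometric.
Context {K : numFieldType}.
Implicit Types (a b c x : K) (u : nat -> K).

Lemma pochhammerSr a n : pochhammer a n.+1 = pochhammer a n * (a + n%:R).
Proof. by rewrite /pochhammer big_ord_recr. Qed.

Lemma pochhammerSl a n : pochhammer a n.+1 = a * pochhammer (a + 1) n.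
Proof.
rewrite /pochhammer big_ord_recl addr0; congr (_ * _); apply: eq_bigr => i _.
by rewrite -addrA -natr1 [1 + _]addrC.
Qed.

Lemma pochhammer1 n : pochhammer (1 : K) n = n`!%:R.
Proof.
elim: n => [|n IH]; first by rewrite /pochhammer big_ord0.
by rewrite pochhammerSr IH factS natrM mulrC nat1r.
Qed.

Lemma pochhammer_neq0 c n : (forall m : nat, c + m%:R != 0) -> pochhammer c n != 0.
Proof. by move=> c0; apply/prodf_neq0 => i _. Qed.

Lemma pochhammer_eq0 m n : (m < n)%N -> pochhammer (- m%:R : K) n = 0.
Proof.
by move=> mn; rewrite /pochhammer (bigD1 (Ordinal mn)) //= addNr mul0r.
Qed.

Definition hypergeo_seq a b c (n : nat) : K :=
  pochhammer a n * pochhammer b n / pochhammer c n / n`!%:R.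

Lemma hypergeoE a b c : hypergeo a b c = psum (hypergeo_seq a b c).
Proof.
apply/funext => x; rewrite /hypergeo /psum; congr (limn (series _)).
by apply/funext => n; rewrite /hypergeo_seq mulrA mulrAC.
Qed.

Lemma hypergeo_seqS a b c n : (forall m : nat, c + m%:R != 0) ->
  n.+1%:R * (c + n%:R) * hypergeo_seq a b c n.+1
    = (a + n%:R) * (b + n%:R) * hypergeo_seq a b c n.
Proof.
move=> c0; rewrite /hypergeo_seq !pochhammerSr factS natrM; field.
by rewrite c0 pochhammer_neq0 // nat1r !pnatr_eq0 -lt0n fact_gt0.
Qed.

(** Coefficient form of the rule for the derivative of F(a, b, c). *)
Lemma hypergeo_seq_up a b c n : (forall m : nat, c + m%:R != 0) ->
  deriv_seq (hypergeo_seq a b c) n =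
    a * b / c * hypergeo_seq (a + 1) (b + 1) (c + 1) n.
Proof.
move=> c0; rewrite /deriv_seq /hypergeo_seq !pochhammerSl factS natrM; field.
rewrite nat1r !pnatr_eq0 -lt0n fact_gt0 /=.
rewrite pochhammer_neq0 => [|m]; last by rewrite -addrA nat1r.
by have := c0 0%N; rewrite addr0 => ->.
Qed.

(** The Pochhammer symbol of [c] of length [n + 1] can be split at its first or at its last
    factor. *)
Lemma hypergeo_seq_cS a b c n : (forall m : nat, c + m%:R != 0) ->
  (c + n%:R) * hypergeo_seq a b (c + 1) n = c * hypergeo_seq a b c n.
Proof.
move=> c0; have cn0 : pochhammer (c + 1) n != 0.
  by apply: pochhammer_neq0 => m; rewrite -addrA nat1r.
have E : pochhammer c n = c * pochhammer (c + 1) n / (c + n%:R).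
  by rewrite -pochhammerSl pochhammerSr mulfK.
have c1 : c != 0 by have := c0 0%N; rewrite addr0.
rewrite /hypergeo_seq E; field.
by rewrite cn0 c1 c0 pnatr_eq0 -lt0n fact_gt0.
Qed.

Definition archimedean : Prop := forall x, exists n : nat, `|x| <= n%:R.

(** From [N] on, [|u n| * r ^+ n] does not increase. The sum of the first [N + 1] such terms serves
    as a common bound, in place of their maximum. *)
Lemma subgeometric_ratio u :
  (forall r : K, 0 < r < 1 -> exists N, forall n, (N <= n)%N ->
     `|u n.+1| * r <= `|u n|) -> subgeometric u.
Proof.
move=> H r r01; have [N HN] := H r r01; have /andP[/ltW r0 _] := r01.
pose v n := `|u n| * r ^+ n.
have v0 n : 0 <= v n by rewrite mulr_ge0 // exprn_ge0.
have vN n : (n <= N)%N -> v n <= \sum_(i < N.+1) v i.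
  move=> nN; rewrite (bigD1 (Ordinal (nN : (n < N.+1)%N))) //= lerDl.
  exact: sumr_ge0.
exists (\sum_(i < N.+1) v i); first exact: sumr_ge0.
move=> n; have [/vN //|] := leqP n N; elim: n => [//|n IH].
rewrite ltnS => nN; apply: (@le_trans _ _ (v n)).
  by rewrite exprS mulrA ler_wpM2r ?exprn_ge0 // HN.
by move: nN; rewrite leq_eqVlt => /orP[/eqP <-|/IH //]; apply: vN.
Qed.

(** The ratio of consecutive terms is [(a + n) / (c + n)]; its norm times [r] is at most 1 once
    [n * (1 - r)] reaches [|c| + |a|]. *)
Lemma subgeometric_pochhammer_div a c : archimedean ->
  (forall m : nat, c + m%:R != 0) ->
  subgeometric (fun n => pochhammer a n / pochhammer c n).
Proof.
move=> arch c0; apply: subgeometric_ratio => r /andP[r0 r1].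
have p : 0 < 1 - r by rewrite subr_gt0.
have [N HN] := arch ((`|c| + `|a|) / (1 - r)); exists N => n Nn.
rewrite !pochhammerSr.
have -> : pochhammer a n * (a + n%:R) / (pochhammer c n * (c + n%:R))
  = pochhammer a n / pochhammer c n * ((a + n%:R) / (c + n%:R)).
  by field; rewrite c0 pochhammer_neq0.
rewrite normrM -mulrA ler_piMr // normf_div mulrAC ler_pdivrMr ?normr_gt0 // mul1r.
have H1 : `|c| + `|a| <= n%:R * (1 - r).
  rewrite -ler_pdivrMr //; apply: le_trans (_ : N%:R <= _); last by rewrite ler_nat.
  apply: le_trans HN; rewrite [X in _ <= X]ger0_norm //.
  by apply: divr_ge0; [exact: addr_ge0 | exact: ltW].
have H2 : `|a + n%:R| * r <= `|a| + n%:R * r.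
  apply: le_trans (ler_wpM2r (ltW r0) (ler_normD _ _)) _.
  by rewrite mulrDl normr_nat lerD2r ler_piMr // ltW.
have H3 : n%:R - `|c| <= `|c + n%:R|.
  by have := lerB_normD n%:R c; rewrite normr_nat (addrC n%:R c).
apply: le_trans H2 (le_trans _ H3).
by rewrite lerBrDr addrAC -lerBrDr (addrC `|a|) -[X in _ <= X - _]mulr1 -mulrBr.
Qed.

(** Reading [n!] as the Pochhammer symbol of 1 splits the coefficient into two quotients of
    Pochhammer symbols. *)
Lemma subgeometric_hypergeo a b c : archimedean ->
  (forall m : nat, c + m%:R != 0) -> subgeometric (hypergeo_seq a b c).
Proof.
move=> arch c0.
have -> : hypergeo_seq a b c = (fun n => pochhammer a n / pochhammer c n *
     (pochhammer b n / pochhammer 1 n)).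
  by apply/funext => n; rewrite /hypergeo_seq pochhammer1 mulrA (mulrAC _ _ (pochhammer b n)).
apply: subgeometricM; apply: subgeometric_pochhammer_div => //.
Qed.

End Hypergeometric.
Arguments archimedean : clear implicits.

(** * First-order differential relations between contiguous hypergeometric functions *)

Section HypergeometricFunction.
Context {K : numFieldType} (Kc : geometric_complete K) (Ka : archimedean K).
Implicit Types (a b c x : K) (u v : nat -> K).

Lemma shift_neq0 c : (forall m : nat, c + m%:R != 0) ->
  forall m : nat, c + 1 + m%:R != 0.
Proof. by move=> c0 m; rewrite -addrA nat1r. Qed.

Lemma shift0_neq0 c : (forall m : nat, c + m%:R != 0) -> c != 0.
Proof. by move=> /(_ 0%N); rewrite addr0. Qed.

Lemma hypergeo0 a b c : (forall m : nat, c + m%:R != 0) -> hypergeo a b c 0 = 1.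
Proof.
move=> c0; rewrite hypergeoE psum0 //; last exact: subgeometric_hypergeo.
by rewrite /hypergeo_seq /pochhammer !big_ord0 fact0 !divr1 mulr1.
Qed.

Lemma psum_deriv_hypergeo a b c x : (forall m : nat, c + m%:R != 0) -> `|x| < 1 ->
  psum (deriv_seq (hypergeo_seq a b c)) x =
    a * b / c * hypergeo (a + 1) (b + 1) (c + 1) x.
Proof.
move=> c0 x1; rewrite hypergeoE -psumZ //; last first.
  by apply: subgeometric_hypergeo => //; exact: shift_neq0.
by congr (psum _ x); apply/funext => n; exact: hypergeo_seq_up.
Qed.

Lemma hypergeo_is_derive a b c x : (forall m : nat, c + m%:R != 0) -> `|x| < 1 ->
  is_derive x 1 (hypergeo a b c) (a * b / c * hypergeo (a + 1) (b + 1) (c + 1) x).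
Proof.
move=> c0 x1; rewrite -psum_deriv_hypergeo // hypergeoE.
by apply: psum_is_derive => //; exact: subgeometric_hypergeo.
Qed.

(* Together with [F' = (a b / c) G] this is the hypergeometric equation, in a
   form that does not degenerate when [a b = 0]. *)
Lemma hypergeo_up_deriv a b c x : (forall m : nat, c + m%:R != 0) -> `|x| < 1 ->
  exists2 g', is_derive x 1 (hypergeo (a + 1) (b + 1) (c + 1)) g' &
    x * (1 - x) * g' = c * hypergeo a b c x
      - (c - (a + b + 1) * x) * hypergeo (a + 1) (b + 1) (c + 1) x.
Proof.
move=> c0 x1; have c10 := shift_neq0 c0; have cn0 := shift0_neq0 c0.
have St := subgeometric_hypergeo a b Ka c0.
have Su := subgeometric_hypergeo (a + 1) (b + 1) Ka c10.
rewrite !hypergeoE.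
set t := hypergeo_seq a b c; set u := hypergeo_seq (a + 1) (b + 1) (c + 1).
exists (psum (deriv_seq u) x); first exact: psum_is_derive.
have Sn := subgeometric_natM Su.
have Sw : subgeometric (fun n => n%:R * u n + (c * u n + - c * t n)).
  by do ?[apply: subgeometricD | apply: subgeometricZ].
(* Both sequences start at 1, so the constant coefficient vanishes and a factor [x] comes out. The
   two recurrences identify the shifted coefficients. *)
have E1 : psum (fun n => n%:R * u n + (c * u n + - c * t n)) x =
   x * psum (fun n => n%:R * u n + (a + b + 1) * u n) x.
  rewrite psumS // mul0r add0r.
  have -> : c * u 0%N + - c * t 0%N = 0.
    by rewrite /u /t /hypergeo_seq /pochhammer !big_ord0; ring.
  rewrite add0r; congr (_ * psum _ x); apply/funext => n.
  have E := hypergeo_seqS (a + 1) (b + 1) n c10; rewrite -/u in E.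
  have E2 := hypergeo_seq_up a b n c0; rewrite -/u -/t /deriv_seq in E2.
  have n0 : n.+1%:R != 0 :> K by rewrite pnatr_eq0.
  apply: (mulfI n0).
  have -> : n.+1%:R * (n.+1%:R * u n.+1 + (c * u n.+1 + - c * t n.+1)) =
    n.+1%:R * (c + 1 + n%:R) * u n.+1 - c * (n.+1%:R * t n.+1).
    by rewrite -natr1; ring.
  by rewrite E E2 -natr1; field.
rewrite !psumD ?psumZ ?psum_natM // in E1;
  try by do ?[apply: subgeometricD | apply: subgeometricZ].
have -> : x * (1 - x) * psum (deriv_seq u) x =
   x * psum (deriv_seq u) x + (c * psum u x + - c * psum t x)
   - x * (x * psum (deriv_seq u) x) - c * psum u x + c * psum t x by ring.
by rewrite E1; ring.
Qed.

(** The operator [x d/dx] multiplies the [n]-th coefficient by [n], so this is [hypergeo_seq_cS]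
    summed over [n]. *)
Lemma hypergeo_c_deriv a b c x : (forall m : nat, c + m%:R != 0) -> `|x| < 1 ->
  exists2 g', is_derive x 1 (hypergeo a b (c + 1)) g' &
    x * g' = c * (hypergeo a b c x - hypergeo a b (c + 1) x).
Proof.
move=> c0 x1; have c10 := shift_neq0 c0.
have Sf := subgeometric_hypergeo a b Ka c0.
have Sg := subgeometric_hypergeo a b Ka c10.
rewrite !hypergeoE; exists (psum (deriv_seq (hypergeo_seq a b (c + 1))) x).
  exact: psum_is_derive.
rewrite -psum_natM // mulrBr -!psumZ //; apply/eqP; rewrite eq_sym subr_eq -psumD //;
  try by do ?[apply: subgeometricZ | apply: subgeometric_natM].
apply/eqP; congr (psum _ x); apply/funext => n.
by rewrite -hypergeo_seq_cS //; ring.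
Qed.

(** Completes [hypergeo_c_deriv] to a first-order system for F(a, b, c) and F(a, b, c+1). On
    coefficients it amounts to [(a + n) * (b + n) - n * (c + n) = a * b + n * (a + b - c)]. *)
Lemma hypergeo_deriv_c a b c x : (forall m : nat, c + m%:R != 0) -> `|x| < 1 ->
  exists2 f', is_derive x 1 (hypergeo a b c) f' &
    c * (1 - x) * f' = a * b * hypergeo a b (c + 1) x
      + c * (a + b - c) * (hypergeo a b c x - hypergeo a b (c + 1) x).
Proof.
move=> c0 x1; have c10 := shift_neq0 c0; have cn0 := shift0_neq0 c0.
have Sf := subgeometric_hypergeo a b Ka c0.
have Sg := subgeometric_hypergeo a b Ka c10.
rewrite !hypergeoE; set f := hypergeo_seq a b c; set g := hypergeo_seq a b (c + 1).
exists (psum (deriv_seq f) x); first exact: psum_is_derive.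
have Sd := subgeometric_deriv Sf; have Sn := subgeometric_natM Sf.
have E : psum (fun n => c * deriv_seq f n + - c * (n%:R * f n)) x =
  psum (fun n => (a * b - c * (a + b - c)) * g n + c * (a + b - c) * f n) x.
  congr (psum _ x); apply/funext => n.
  have cn := c0 n.
  have E1 : g n = c * f n / (c + n%:R).
    by rewrite -hypergeo_seq_cS // mulrC mulKf.
  have E2 : deriv_seq f n = (a + n%:R) * (b + n%:R) * f n / (c + n%:R).
    by rewrite -hypergeo_seqS // /deriv_seq -/f; field.
  by rewrite E1 E2; field.
rewrite !psumD ?psumZ // ?psum_natM // in E; try by apply: subgeometricZ.
have -> : c * (1 - x) * psum (deriv_seq f) x = c * psum (deriv_seq f) x
  + - c * (x * psum (deriv_seq f) x) by ring.
by rewrite E; ring.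
Qed.

Lemma hypergeo_terminating a b c n x : (forall m : nat, c + m%:R != 0) ->
  a = - n%:R \/ b = - n%:R -> `|x| < 1 ->
  hypergeo a b c x = (\poly_(i < n.+1) hypergeo_seq a b c i).[x].
Proof.
move=> c0 ab x1; rewrite hypergeoE horner_poly; apply: psum_eq.
have H i : (n < i)%N -> hypergeo_seq a b c i = 0.
  by move=> ni; case: ab => ->; rewrite /hypergeo_seq pochhammer_eq0 // ?mul0r // mulr0 !mul0r.
apply: cvg_near_cst; exists n.+1 => // m /= nm.
rewrite /series /= (big_cat_nat (leq0n n.+1)) //= big_mkord.
rewrite -[RHS]addr0; congr (_ + _).
by rewrite big_nat big1 // => i /andP[ni _]; rewrite H // mul0r.
Qed.

End HypergeometricFunction.

(** * From the Riccati equation to the sixth Painlevé equation *)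

Section Riccati.
Context {K : numFieldType}.
Implicit Types (k mu s x : K) (y f g : K -> K) (D : set K).

Lemma is_derive_continuous f x l : is_derive x 1 f l -> {for x, continuous f}.
Proof. by move=> H; apply/differentiable_continuous/derivable1_diffP. Qed.

Lemma is_derive_unique f x l l' : is_derive x 1 f l -> is_derive x 1 f l' -> l = l'.
Proof. by move=> H H'; rewrite -(@derive_val _ _ _ _ _ _ _ H) derive_val. Qed.

Lemma is_derive_inv f x l : f x != 0 -> is_derive x 1 f l ->
  is_derive x 1 (fun z => (f z)^-1) (- (f x) ^- 2 * l).
Proof.
move=> fx H; apply: DeriveDef; first exact: derivableV.
by rewrite deriveV // derive_val.
Qed.

Lemma near_eq_is_derive1 D f g x l : (\forall z \near x, D z) ->
  (forall z, D z -> f z = g z) -> is_derive x 1 f l -> is_derive x 1 g l.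
Proof. by move=> Dx fg; apply: near_eq_is_derive; apply: filterS Dx. Qed.

Definition riccati k mu s x (y y' : K) : Prop :=
  x * (1 - x) * y' = k * y ^+ 2 + (1 - s - (k + mu + 1) * x) * y + (s + mu) * x.

(** The second equation is the derivative of the Riccati equation along a solution. Solving the two
    for [y'] and [y''] turns the claim into an identity of rational functions in [x] and [y]. *)
Lemma riccati_PVI_rhs k mu s x (y y' y'' : K) :
  x != 0 -> x != 1 -> y != 0 -> y != 1 -> y != x -> riccati k mu s x y y' ->
  (1 - 2 * x) * y' + x * (1 - x) * y'' =
    2 * k * y * y' + (1 - s - (k + mu + 1) * x) * y' - (k + mu + 1) * y + (s + mu) ->
  y'' = PVI_rhs (k ^+ 2 / 2) (- (mu + s) ^+ 2 / 2) ((k - s + 1) ^+ 2 / 2)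
          ((1 - mu ^+ 2) / 2) x y y'.
Proof.
move=> x0 x1 y0 y1 yx R1 R2.
have x10 : 1 - x != 0 by rewrite subr_eq0 eq_sym.
have xx0 : x * (1 - x) != 0 by rewrite mulf_neq0.
have E1 : y' = (k * y ^+ 2 + (1 - s - (k + mu + 1) * x) * y + (s + mu) * x)
    / (x * (1 - x)) by rewrite -R1 mulrC mulKf.
have E2 : y'' = (2 * k * y * y' + (1 - s - (k + mu + 1) * x) * y'
    - (k + mu + 1) * y + (s + mu) - (1 - 2 * x) * y') / (x * (1 - x)).
  by rewrite -R2 addrAC subrr add0r mulrC mulKf.
rewrite E2 /PVI_rhs E1; field.
by rewrite x0 y0 x10 !subr_eq0 x1 y1 yx.
Qed.

Lemma riccati_PVI_solution D k mu s y :
  (forall x, D x -> [/\ x != 0, x != 1 & \forall z \near x, D z]) ->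
  (forall x, D x -> exists2 y', is_derive x 1 y y' & riccati k mu s x (y x) y') ->
  PVI_solution_on D (k ^+ 2 / 2) (- (mu + s) ^+ 2 / 2) ((k - s + 1) ^+ 2 / 2)
          ((1 - mu ^+ 2) / 2) y.
Proof.
move=> HD HR.
have dy x : D x -> is_derive x 1 y (derive1 y x) /\ riccati k mu s x (y x) (derive1 y x).
  move=> /HR[y' H R]; have <- : y' = derive1 y x by rewrite derive1E derive_val.
  by [].
pose Q x := (k * y x ^+ 2 + (1 - s - (k + mu + 1) * x) * y x + (s + mu) * x).
have dQ x : D x -> is_derive x 1 Q (2 * k * y x * derive1 y x
   + (1 - s - (k + mu + 1) * x) * derive1 y x - (k + mu + 1) * y x + (s + mu)).
  move=> Dx; have [H _] := dy x Dx.
  have -> : Q = cst k * (y * y) + (cst (1 - s) - cst (k + mu + 1) * id) * y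
    + cst (s + mu) * id by apply/funext => z; rewrite /Q expr2.
  apply: is_derive_eq; rewrite !fctE /GRing.scale /=; ring.
(* Second derivability comes from the equation itself: near [x], [derive1 y] is [Q] divided by
   [z * (1 - z)], and [Q] is polynomial in [z] and [y z]. *)
have dd x : D x -> derivable (derive1 y) x 1.
  move=> Dx; have [x0 x1 Dn] := HD x Dx.
  have xx0 z : D z -> z * (1 - z) != 0.
    by move=> /HD[z0 z1 _]; rewrite mulf_neq0 // subr_eq0 eq_sym.
  apply: (@near_eq_derivable _ _ _ (Q * (fun z => ((id * (cst 1 - id)) z)^-1))).
    apply: filterS Dn => z Dz; have [_ R] := dy z Dz.
    by rewrite !fctE /Q -R mulrC mulKf // xx0.
  have dQx := dQ x Dx; apply: derivableM => //; apply: derivableV; first exact: xx0.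
  by apply: derivableM => //; apply: derivableB.
split => // x Dx; first by have [[]] := dy x Dx.
move=> [y0 y1 yx]; have [x0 x1 Dn] := HD x Dx; have [H R] := dy x Dx.
apply: riccati_PVI_rhs => //.
have H2 : is_derive x 1 (derive1 y) (derive1 (derive1 y) x).
  by apply: DeriveDef; [exact: dd | rewrite derive1E].
(* Both sides of the Riccati equation agree near [x], so their derivatives at [x] coincide. *)
have : is_derive x 1 (id * (cst 1 - id) * derive1 y)
   ((1 - 2 * x) * derive1 y x + x * (1 - x) * derive1 (derive1 y) x).
  by apply: is_derive_eq; rewrite !fctE /GRing.scale /=; ring.
move=> /is_derive_unique; apply.
apply: near_eq_is_derive1 Dn _ (dQ x Dx) => z Dz.
by have [_ R'] := dy z Dz; rewrite !fctE /Q -R'.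
Qed.

Lemma punctured_disc_off_open f x :
  (forall x, `|x| < 1 -> {for x, continuous f}) ->
  punctured_disc_off f x ->
  [/\ x != 0, x != 1 & \forall z \near x, punctured_disc_off f z].
Proof.
move=> cf [/andP[x0 x1] fx]; split.
- by rewrite -normr_gt0.
- by apply: contraTneq x1 => ->; rewrite normr1 ltxx.
near=> z; split; last by near: z; exact: (cvgr_neq0 _ (cf x x1) fx).
apply/andP; split; last by near: z; exact: open_unit_disc.
by rewrite normr_gt0; near: z; apply: (cvgr_neq0 _ cvg_id); rewrite -normr_gt0.
Unshelve. all: by end_near. Qed.

End Riccati.

(** * Rationality from a polynomial relation *)

Section Rationality.
Context {K : numFieldType}.
Implicit Types (p q f g : {poly K}) (x : K) (D : set K).

Lemma horner_continuous p : continuous (horner p).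
Proof.
elim/poly_ind: p => [|p c IH] x.
  have -> : horner (0 : {poly K}) = cst 0 by apply/funext => z; rewrite horner0.
  exact: cst_continuous.
have -> : horner (p * 'X + c%:P) = (fun z => p.[z] * z + c).
  by apply/funext => z; rewrite hornerMXaddC.
exact: (cvgD (cvgM (IH x) cvg_id) (cvg_cst c)).
Qed.

(** Factor out the full power of ['X - x]: the cofactor is nonzero at [x], hence nearby. *)
Lemma near_horner_neq0 p x : p != 0 -> \forall z \near x^', p.[z] != 0.
Proof.
move=> p0; have [m [q]] := multiplicity_XsubC p x; rewrite p0 /= => qx pE.
have q0 : \forall z \near x, q.[z] != 0 by exact: (cvgr_neq0 _ (@horner_continuous q x) qx).
have qn : \forall z \near x^', q.[z] != 0 := nbhs_dnbhs q0.
near=> z; rewrite pE hornerM horner_exp hornerXsubC mulf_neq0 //.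
  by near: z.
by rewrite expf_neq0 // subr_eq0; near: z; exact: nbhs_dnbhs_neq.
Unshelve. all: by end_near. Qed.

(* After cancelling the gcd of [f] and [g] the relation still holds at the
   zeros of the gcd, by continuity, and the denominator no longer vanishes. *)
Lemma rational_on_of_mul D (r : K -> K) f g :
  (forall x, D x -> \forall z \near x, D z) ->
  (forall x, D x -> {for x, continuous r}) ->
  f != 0 -> (forall x, D x -> r x * f.[x] = g.[x]) -> rational_on D r.
Proof.
move=> Do Dr f0 E; pose d := gcdp f g.
have d0 : d != 0 by rewrite gcdp_eq0 negb_and f0.
have fE : f = f %/ d * d by rewrite divpK // dvdp_gcdl.
have gE : g = g %/ d * d by rewrite divpK // dvdp_gcdr.
have cop : coprimep (f %/ d) (g %/ d) by apply: coprimep_div_gcd; rewrite f0.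
have H x : D x -> r x * (f %/ d).[x] = (g %/ d).[x].
  move=> Dx; apply/eqP; rewrite -subr_eq0; apply/eqP.
  pose h z := r z * (f %/ d).[z] - (g %/ d).[z].
  have hc : h z @[z --> x^'] --> h x.
    apply/continuous_withinNx.
    exact: (cvgB (cvgM (Dr x Dx) (@horner_continuous _ x)) (@horner_continuous _ x)).
  have h0 : h z @[z --> x^'] --> (0 : K).
    apply: cvg_near_cst; near=> z.
    have dz : d.[z] != 0 by near: z; exact: near_horner_neq0.
    have Dz : D z by near: z; exact: (nbhs_dnbhs (Do x Dx)).
    apply: (mulIf dz); rewrite mul0r mulrBl -mulrA -!hornerM -fE -gE E //.
    exact: subrr.
  exact: cvg_unique hc h0.
exists (g %/ d), (f %/ d) => x Dx.
(* By the reduced relation, a zero of [f %/ d] in [D] would also be a zero of [g %/ d], against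
   coprimality. *)
have fx : (f %/ d).[x] != 0.
  apply/negP => fx; have /negP := coprimep_root cop fx; apply.
  by rewrite -H // (eqP fx) mulr0.
by split => //; rewrite -H // mulfK.
Unshelve. all: by end_near. Qed.

End Rationality.

(** * Euler's transformation for the ratio of contiguous functions *)

Section Euler.
Context {K : numFieldType} (Kc : geometric_complete K) (Ka : archimedean K).
Implicit Types (a b c x : K) (u v : nat -> K).

(** Built along the polynomial, multiplication by ['X] being a shift of the coefficients. It
    presents the difference D of Euler's relation as one power series. *)
Lemma psum_mul_poly u (p : {poly K}) : subgeometric u ->
  exists2 v, subgeometric v & forall x, `|x| < 1 -> psum v x = psum u x * p.[x].
Proof.
move=> Hu; elim/poly_ind: p => [|p c [v Hv IH]].
  exists (fun n => 0 * u n); first exact: subgeometricZ.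
  by move=> x x1; rewrite psumZ // horner0 mulr0 mul0r.
have Hs := subgeometric_shift Hv.
have Hc := subgeometricZ c Hu.
exists (fun n => (if n is m.+1 then v m else 0) + c * u n).
  exact: subgeometricD.
move=> x x1; rewrite psumD // psumZ // psumS // add0r IH // hornerMXaddC.
by ring.
Qed.

Lemma hypergeo_euler_ratio a b c n x : (forall m : nat, c + m%:R != 0) ->
  c - a = - n%:R \/ c - b = - n%:R -> `|x| < 1 ->
  (1 - x) * hypergeo (a + 1) (b + 1) (c + 1) x * hypergeo (c - a) (c - b) c x =
  hypergeo a b c x * hypergeo (c - a) (c - b) (c + 1) x.
Proof.
move=> c0 cab; have c10 := shift_neq0 c0; have cn0 := shift0_neq0 c0.
have Ht := subgeometric_hypergeo a b Ka c0.
have Hu := subgeometric_hypergeo (a + 1) (b + 1) Ka c10.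
pose pf := \poly_(i < n.+1) hypergeo_seq (c - a) (c - b) c i.
pose pg := \poly_(i < n.+1) hypergeo_seq (c - a) (c - b) (c + 1) i.
have [v1 Hv1 E1] := psum_mul_poly ((1 - 'X) * pf) Hu.
have [v2 Hv2 E2] := psum_mul_poly (- pg) Ht.
have Hv := subgeometricD Hv1 Hv2; set v := (fun n => _) in Hv.
pose d x := (1 - x) * hypergeo (a + 1) (b + 1) (c + 1) x * hypergeo (c - a) (c - b) c x -
  hypergeo a b c x * hypergeo (c - a) (c - b) (c + 1) x.
have vE z : `|z| < 1 -> psum v z = d z.
  move=> z1; rewrite psumD // E1 // E2 // hornerM hornerN -!hypergeoE.
  rewrite -!(hypergeo_terminating (n := n)) // hornerD hornerN hornerX hornerC.
  by rewrite /d; ring.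
suff v0 m : v m = 0.
  move=> x1; apply/eqP; rewrite -subr_eq0 -/(d x) -vE //; apply/eqP.
  apply: psum_eq; rewrite (_ : series _ = cst 0); first exact: cvg_cst.
  by apply/funext => i; rewrite /series /= big1 // => j _; rewrite v0 mul0r.
have Hn := subgeometric_natM Hv; have Hcv := subgeometricZ c Hv.
(* The coefficient form of [x D' + c D = 0]; [c + m] is nonzero, so [v m] vanishes. *)
suff : m%:R * v m + c * v m = 0.
  by rewrite -mulrDl addrC => /eqP; rewrite mulf_eq0 (negPf (c0 m)) => /eqP.
apply: (psum_eq0 Kc (subgeometricD Hn Hcv)) => z z1.
rewrite psumD // psumZ // psum_natM // vE //.
have [g' dg Eg] := hypergeo_c_deriv Kc Ka (c - a) (c - b) c0 z1.
have [f' df Ef] := hypergeo_deriv_c Kc Ka (c - a) (c - b) c0 z1.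
have [G' dG EG] := hypergeo_up_deriv Kc Ka a b c0 z1.
have dF := hypergeo_is_derive Kc Ka a b c0 z1.
move: dF dG df dg Eg Ef EG; rewrite /d.
set F := hypergeo a b c; set G := hypergeo (a + 1) (b + 1) (c + 1).
set f := hypergeo (c - a) (c - b) c; set g := hypergeo (c - a) (c - b) (c + 1).
move=> dF dG df dg Eg Ef EG.
have dd : is_derive z 1 ((cst 1 - id) * G * f - F * g)
   (- G z * f z + (1 - z) * G' * f z + (1 - z) * G z * f'
      - (a * b / c * G z * g z + F z * g')).
  by apply: is_derive_eq; rewrite !fctE /GRing.scale /=; ring.
have -> := is_derive_unique (psum_is_derive Kc Hv z1)
  (near_eq_is_derive1 (open_unit_disc z1) (fun y y1 => esym (vE y y1)) dd).
(* Regrouped so that each derivative appears with exactly the factor that its differential relation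
   provides. *)
have -> : z * (- G z * f z + (1 - z) * G' * f z + (1 - z) * G z * f'
      - (a * b / c * G z * g z + F z * g')) =
   - z * G z * f z + z * (1 - z) * G' * f z + z * G z * (c * (1 - z) * f') / c
      - z * a * b / c * G z * g z - F z * (z * g') by field.
by rewrite Eg Ef EG; field.
Qed.

End Euler.

(** * Rationality of the hypergeometric ratio; the Riccati equation for both functions *)

Section PainleveSolutions.
Context {K : numFieldType} (Kc : geometric_complete K) (Ka : archimedean K).
Implicit Types (a b c k mu s x : K).

(** Up to the factor [a * b / c], this is [1 - x] times the logarithmic derivative of F(a, b, c). It
    keeps its meaning when [a * b = 0], and it is the side of Euler's relation that may become
    rational. *)
Definition hypergeo_ratio a b c x : K :=
  (1 - x) * (hypergeo (a + 1) (b + 1) (c + 1) x / hypergeo a b c x).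

Lemma hypergeo_continuous a b c x : (forall m : nat, c + m%:R != 0) -> `|x| < 1 ->
  {for x, continuous (hypergeo a b c)}.
Proof. by move=> c0 x1; exact: is_derive_continuous (hypergeo_is_derive Kc Ka a b c0 x1). Qed.

Lemma hypergeo_ratio_derivable a b c x : (forall m : nat, c + m%:R != 0) ->
  `|x| < 1 -> hypergeo a b c x != 0 -> derivable (hypergeo_ratio a b c) x 1.
Proof.
move=> c0 x1 Fx; have dF := hypergeo_is_derive Kc Ka a b c0 x1.
have dG := hypergeo_is_derive Kc Ka (a + 1) (b + 1) (shift_neq0 c0) x1.
have -> : hypergeo_ratio a b c = (cst 1 - id) *
   (hypergeo (a + 1) (b + 1) (c + 1) * (fun z => (hypergeo a b c z)^-1)) by [].
by apply: derivableM; [apply: derivableB | apply: derivableM => //; apply: derivableV].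
Qed.

Lemma hypergeo_domain_open a b c x : (forall m : nat, c + m%:R != 0) ->
  punctured_disc_off (hypergeo a b c) x ->
  [/\ x != 0, x != 1 & \forall z \near x, punctured_disc_off (hypergeo a b c) z].
Proof.
by move=> c0; apply: punctured_disc_off_open => z; exact: hypergeo_continuous.
Qed.

(** In the first two cases the numerator has parameters [a + 1] and [b + 1], so termination of both
    series takes a strictly negative integer. In the last two, numerator and denominator after
    Euler's transformation share the parameters [c - a] and [c - b], so 0 is allowed. *)
Lemma hypergeo_ratio_rational a b c (n : nat) : (forall m : nat, c + m%:R != 0) ->
  [\/ a = - n.+1%:R, b = - n.+1%:R, c - a = - n%:R | c - b = - n%:R] ->
  rational_on (punctured_disc_off (hypergeo a b c)) (hypergeo_ratio a b c).
Proof.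
move=> c0 H; have c10 := shift_neq0 c0.
(* A polynomial relation suffices, even if [f] has zeros in the domain; the value at 0 shows that
   [f] is not the zero polynomial. *)
suff [f [g [f0 E]]] : exists f g : {poly K}, f.[0] != 0 /\
    forall x, punctured_disc_off (hypergeo a b c) x ->
      hypergeo_ratio a b c x * f.[x] = g.[x].
  apply: (@rational_on_of_mul _ _ _ f g) => // [x Dx|x [/andP[_ x1] Fx]|].
  - by have [] := hypergeo_domain_open c0 Dx.
  - by apply/differentiable_continuous/derivable1_diffP; exact: hypergeo_ratio_derivable.
  - by apply: contraNneq f0 => ->; rewrite horner0.
have e1 : - n.+1%:R + 1 = - n%:R :> K by rewrite -natr1 opprD subrK.
have z1 : `|0 : K| < 1 by rewrite normr0.
have [ab|cab] : (a = - n.+1%:R \/ b = - n.+1%:R) \/ (c - a = - n%:R \/ c - b = - n%:R).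
  by case: H; tauto.
- have ab1 : a + 1 = - n%:R \/ b + 1 = - n%:R.
    by case: ab => ->; [left|right].
  exists (\poly_(i < n.+2) hypergeo_seq a b c i),
    ((1 - 'X) * \poly_(i < n.+1) hypergeo_seq (a + 1) (b + 1) (c + 1) i); split.
    by rewrite -hypergeo_terminating // hypergeo0 // oner_neq0.
  move=> x [/andP[_ x1] Fx]; rewrite hornerM -!hypergeo_terminating // /hypergeo_ratio.
  by rewrite hornerD hornerN hornerX hornerC -mulrA divfK.
exists (\poly_(i < n.+1) hypergeo_seq (c - a) (c - b) c i),
  (\poly_(i < n.+1) hypergeo_seq (c - a) (c - b) (c + 1) i); split.
  by rewrite -hypergeo_terminating // hypergeo0 // oner_neq0.
move=> x [/andP[_ x1] Fx]; rewrite -!hypergeo_terminating // /hypergeo_ratio.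
apply: (mulfI Fx); rewrite -(hypergeo_euler_ratio Kc Ka c0 cab x1); field.
exact: Fx.
Qed.

Lemma y1E k mu s x :
  y1 k mu s x = x * (1 + mu / s * hypergeo_ratio k (- mu) s x).
Proof. by rewrite /y1 /hypergeo_ratio (addrC 1 (- mu)); congr (_ * (_ + _)); ring. Qed.

(** For [x] other than 0 and 1 this is [k * y2], with the factor [x * (x - 1)] multiplied out.
    Unlike the formula of [y2], it has no division by [x], so it can be evaluated at 0. *)
Definition y2_num k mu s x : K := (x - 1) * (1 - s) + k * x
  - x * ((k - s + 1) * (1 - mu - s) / (2 - s)
         * hypergeo_ratio (k - s + 1) (1 - mu - s) (2 - s) x).

Lemma y2E k mu s x : x != 0 -> x != 1 -> k != 0 -> y2 k mu s x = y2_num k mu s x / k.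
Proof.
move=> x0 x1 k0; rewrite /y2 /y2_num /hypergeo_ratio.
have -> : k - s + 1 + 1 = k - s + 2 by ring.
have -> : 1 - mu - s + 1 = 2 - mu - s by ring.
have -> : 2 - s + 1 = 3 - s by ring.
set r := _ / hypergeo _ _ _ _; set d := _ / (2 - s); field.
by rewrite x0 k0 subr_eq0 eq_sym x1.
Qed.

Lemma y1_riccati k mu s x : (forall m : nat, s + m%:R != 0) -> dom1 k mu s x ->
  exists2 y', is_derive x 1 (y1 k mu s) y' & riccati k mu s x (y1 k mu s x) y'.
Proof.
move=> s0 Dx; have [x0 x1 Dn] := hypergeo_domain_open s0 Dx.
have [/andP[_ xd] Fx] := Dx; have sn0 := shift0_neq0 s0.
have dF := hypergeo_is_derive Kc Ka k (- mu) s0 xd.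
have [G' dG EG] := hypergeo_up_deriv Kc Ka k (- mu) s0 xd.
have x10 : 1 - x != 0 by rewrite subr_eq0 eq_sym.
have xx0 : x * (1 - x) != 0 by rewrite mulf_neq0.
have -> : y1 k mu s = (fun x => x * (1 + mu / s * hypergeo_ratio k (- mu) s x)).
  by apply/funext => z; exact: y1E.
rewrite /hypergeo_ratio.
move: Fx dF dG EG; set F := hypergeo _ _ _; set G := hypergeo (k + 1) _ _.
move=> Fx dF dG EG; have dV := is_derive_inv Fx dF.
exists (1 + mu / s * ((1 - x) * (G x / F x)) +
  x * (mu / s * (- (G x / F x) + (1 - x) * (G' / F x + G x * (- (F x) ^- 2 * (k * - mu / s * G x)))))).
  have -> : (fun x => x * (1 + mu / s * ((1 - x) * (G x / F x)))) =
    id * (cst 1 + cst (mu / s) * ((cst 1 - id) * (G * (fun z => (F z)^-1)))) by [].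
  by apply: is_derive_eq; rewrite !fctE /GRing.scale /=; ring.
(* Eliminating the derivative of [G] leaves a rational identity in [x], [F x] and [G x]. *)
have -> : G' = (s * F x - (s - (k - mu + 1) * x) * G x) / (x * (1 - x)).
  by rewrite -EG mulrC mulKf.
rewrite /riccati; field.
by rewrite sn0 Fx x0 x10.
Qed.

(** The bracket in [y2] is formally the logarithmic derivative of x^(1-s) (1-x)^k F(k-s+1, 1-mu-s,
    2-s, x). The computation itself goes through [y2_num], which involves no complex powers. *)
Lemma y2_riccati k mu s x : (forall m : nat, 2 - s + m%:R != 0) -> k != 0 ->
  dom2 k mu s x ->
  exists2 y', is_derive x 1 (y2 k mu s) y' & riccati k mu s x (y2 k mu s x) y'.
Proof.
move=> s0 k0 Dx; have [x0 x1 Dn] := hypergeo_domain_open s0 Dx.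
have [/andP[_ xd] Fx] := Dx; have sn0 := shift0_neq0 s0.
have dF := hypergeo_is_derive Kc Ka (k - s + 1) (1 - mu - s) s0 xd.
have [G' dG EG] := hypergeo_up_deriv Kc Ka (k - s + 1) (1 - mu - s) s0 xd.
have x10 : 1 - x != 0 by rewrite subr_eq0 eq_sym.
have xx0 : x * (1 - x) != 0 by rewrite mulf_neq0.
pose a := k - s + 1; pose b := 1 - mu - s; pose c := 2 - s.
move: Fx dF dG EG; rewrite -/a -/b -/c.
set F := hypergeo _ _ _; set G := hypergeo (a + 1) _ _.
move=> Fx dF dG EG; have dV := is_derive_inv Fx dF.
exists (((1 - s) + k - a * b / c * ((1 - x) * (G x / F x)) - x * (a * b / c *
  (- (G x / F x) + (1 - x) * (G' / F x + G x * (- (F x) ^- 2 * (a * b / c * G x)))))) / k).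
  (* [y2E] holds only away from 0 and 1, so the derivative is transferred along an equality near
     [x]. *)
  apply: (@near_eq_is_derive1 _ (dom2 k mu s)
     (((id - cst 1) * cst (1 - s) + cst k * id - id * (cst (a * b / c) *
       ((cst 1 - id) * (G * (fun z => (F z)^-1))))) * cst k^-1)) Dn _ _.
    by move=> z /(hypergeo_domain_open s0)[z0 z1 _]; rewrite y2E.
  by apply: is_derive_eq; rewrite !fctE /GRing.scale /=; ring.
have -> : G' = (c * F x - (c - (a + b + 1) * x) * G x) / (x * (1 - x)).
  by rewrite -EG mulrC mulKf.
rewrite /riccati y2E // /y2_num /hypergeo_ratio -/a -/b -/c -/F -/G /a /b /c; field.
by rewrite sn0 Fx x0 x10 k0.
Qed.

End PainleveSolutions.

(** * Behaviour near 0, and rationality of the two solutions *)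

Section NonDegenerate.
Context {K : numFieldType} (Kc : geometric_complete K) (Ka : archimedean K).
Implicit Types (a b c k mu s x : K).

Lemma near_neq0 (f : K -> K) x : derivable f x 1 -> f x != 0 ->
  \forall z \near x^', f z != 0.
Proof.
move=> /derivable1_diffP/differentiable_continuous fc fx.
have H : \forall z \near x, f z != 0 by exact: (cvgr_neq0 _ fc fx).
exact: (nbhs_dnbhs H).
Qed.

Lemma hypergeo_ratio0 a b c : (forall m : nat, c + m%:R != 0) ->
  hypergeo_ratio a b c 0 = 1.
Proof.
move=> c0; rewrite /hypergeo_ratio !hypergeo0 //; last exact: shift_neq0.
by rewrite subr0 divr1 mulr1.
Qed.
Arguments hypergeo_ratio0 a b {c} _.

Lemma hypergeo_ratio_derivable0 a b c : (forall m : nat, c + m%:R != 0) ->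
  derivable (hypergeo_ratio a b c) 0 1.
Proof.
by move=> c0; apply: hypergeo_ratio_derivable; rewrite ?normr0 // hypergeo0 // oner_neq0.
Qed.
Arguments hypergeo_ratio_derivable0 a b {c} _.

(** F is 1 at 0, hence nonzero nearby. Test points for the statements below are taken close to 0. *)
Lemma near0_domain a b c : (forall m : nat, c + m%:R != 0) ->
  \forall z \near 0^', punctured_disc_off (hypergeo a b c) z.
Proof.
move=> c0; have z1 : `|0 : K| < 1 by rewrite normr0.
have dF := hypergeo_is_derive Kc Ka a b c0 z1.
near=> z; split; last first.
  by near: z; apply: near_neq0 => //; rewrite hypergeo0 // oner_neq0.
rewrite normr_gt0; apply/andP; split; near: z; first exact: nbhs_dnbhs_neq.
exact: dnbhs0_lt.
Unshelve. all: by end_near. Qed.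

Lemma y1_derivable0 k mu s : (forall m : nat, s + m%:R != 0) ->
  derivable (y1 k mu s) 0 1.
Proof.
move=> s0; have dr := hypergeo_ratio_derivable0 k (- mu) s0.
have -> : y1 k mu s = id * (cst 1 + cst (mu / s) * hypergeo_ratio k (- mu) s).
  by apply/funext => z; exact: y1E.
by apply: derivableM => //; apply: derivableD => //; apply: derivableM.
Qed.
Arguments y1_derivable0 k mu {s} _.

(** At 0 the ratio is 1. So [y1 / x] tends to [(s + mu) / s], [y1 - 1] tends to -1, and
    [(y1 - x) / x] tends to [mu / s]; all three limits are nonzero. *)
Lemma y1_nondegenerate k mu s : (forall m : nat, s + m%:R != 0) ->
  mu != 0 -> mu + s != 0 -> PVI_nondegenerate_on (dom1 k mu s) (y1 k mu s).
Proof.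
move=> s0 mu0 mus; have sn0 := shift0_neq0 s0.
have dr := hypergeo_ratio_derivable0 k (- mu) s0.
have r0 := hypergeo_ratio0 k (- mu) s0.
have dy := y1_derivable0 k mu s0.
have y00 : y1 k mu s 0 = 0 by rewrite y1E mul0r.
suff : \forall z \near (0 : K)^', dom1 k mu s z /\ PVI_regular (y1 k mu s) z.
  by move=> /filter_ex[z [Dz Rz]]; exists z.
near=> z; split; first by near: z; exact: near0_domain.
have z0 : z != 0 by near: z; exact: nbhs_dnbhs_neq.
split.
- rewrite y1E mulf_neq0 //; near: z.
  apply: (near_neq0 (f := cst 1 + cst (mu / s) * hypergeo_ratio k (- mu) s)).
    by apply: derivableD => //; apply: derivableM.
  rewrite !fctE r0 mulr1 -[1](divff sn0) -mulrDl mulf_neq0 ?invr_eq0 //.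
  by rewrite addrC.
- rewrite -subr_eq0; near: z; apply: (near_neq0 (f := y1 k mu s - cst 1)).
    exact: derivableB.
  by rewrite !fctE y00 sub0r oppr_eq0 oner_neq0.
- rewrite y1E -subr_eq0 mulrDr mulr1 addrAC subrr add0r.
  have ms : mu / s != 0 by rewrite mulf_neq0 ?invr_eq0.
  apply: mulf_neq0 => //; apply: mulf_neq0 => //; near: z.
  by apply: near_neq0 => //; rewrite r0 oner_neq0.
Unshelve. all: by end_near. Qed.

Lemma y2_num_derivable0 k mu s : (forall m : nat, 2 - s + m%:R != 0) ->
  derivable (y2_num k mu s) 0 1.
Proof.
move=> s0; have dr := hypergeo_ratio_derivable0 (k - s + 1) (1 - mu - s) s0.
have -> : y2_num k mu s = (id - cst 1) * cst (1 - s) + cst k * id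
  - id * (cst ((k - s + 1) * (1 - mu - s) / (2 - s))
         * hypergeo_ratio (k - s + 1) (1 - mu - s) (2 - s)) by [].
apply: derivableB; last by apply: derivableM => //; apply: derivableM.
apply: derivableD; last exact: derivableM.
by apply: derivableM => //; apply: derivableB.
Qed.
Arguments y2_num_derivable0 k mu {s} _.

Lemma y2_num0 k mu s : y2_num k mu s 0 = s - 1.
Proof. by rewrite /y2_num; ring. Qed.

(** The limit of [y2] at 0 is [(s - 1) / k]. It differs from 0 because [s != 1], which also
    separates [y2] from [x], and from 1 because [k - s + 1 != 0]. *)
Lemma y2_nondegenerate k mu s : (forall m : nat, 2 - s + m%:R != 0) ->
  k != 0 -> s != 1 -> k - s + 1 != 0 ->
  PVI_nondegenerate_on (dom2 k mu s) (y2 k mu s).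
Proof.
move=> s0 k0 s1 ks; have dn := y2_num_derivable0 k mu s0.
suff : \forall z \near (0 : K)^', dom2 k mu s z /\ PVI_regular (y2 k mu s) z.
  by move=> /filter_ex[z [Dz Rz]]; exists z.
near=> z.
have Dz : dom2 k mu s z by near: z; exact: near0_domain.
split => //; have [z0 z1 _] := hypergeo_domain_open Kc Ka s0 Dz.
rewrite /PVI_regular y2E //; split.
- rewrite mulf_neq0 ?invr_eq0 //; near: z.
  by apply: near_neq0 => //; rewrite y2_num0 subr_eq0.
- rewrite -subr_eq0 -(divff k0) -mulrBl mulf_neq0 ?invr_eq0 //; near: z.
  apply: (near_neq0 (f := y2_num k mu s - cst k)); first exact: derivableB.
  rewrite !fctE y2_num0 -oppr_eq0.
  by have -> : - (s - 1 - k) = k - s + 1 by ring.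
- rewrite -subr_eq0 -[X in _ - X](mulfK k0) -mulrBl mulf_neq0 ?invr_eq0 //; near: z.
  apply: (near_neq0 (f := y2_num k mu s - id * cst k)).
    by apply: derivableB => //; apply: derivableM.
  by rewrite !fctE y2_num0 mul0r subr0 subr_eq0.
Unshelve. all: by end_near. Qed.

(** At 0, [y1] tends to 0 and [y2] to [(s - 1) / k], which is nonzero. *)
Lemma y1_neq_y2 k mu s : (forall m : nat, s + m%:R != 0) ->
  (forall m : nat, 2 - s + m%:R != 0) -> k != 0 -> s != 1 ->
  exists x, [/\ dom1 k mu s x, dom2 k mu s x & y2 k mu s x != y1 k mu s x].
Proof.
move=> s0 s20 k0 s1; have dn := y2_num_derivable0 k mu s20.
have dy := y1_derivable0 k mu s0.
have y00 : y1 k mu s 0 = 0 by rewrite y1E mul0r.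
suff : \forall z \near (0 : K)^',
  [/\ dom1 k mu s z, dom2 k mu s z & y2 k mu s z != y1 k mu s z].
  by move=> /filter_ex[z Hz]; exists z.
near=> z.
have Dz : dom2 k mu s z by near: z; exact: near0_domain.
split => //; first by near: z; exact: near0_domain.
have [z0 z1 _] := hypergeo_domain_open Kc Ka s20 Dz.
rewrite y2E // -subr_eq0 -[X in _ - X](mulfK k0) -mulrBl mulf_neq0 ?invr_eq0 //; near: z.
apply: (near_neq0 (f := y2_num k mu s - y1 k mu s * cst k)).
  by apply: derivableB => //; apply: derivableM.
by rewrite !fctE y2_num0 y00 mul0r subr0 subr_eq0.
Unshelve. all: by end_near. Qed.

Lemma y1_rational k mu s (n : nat) : (forall m : nat, s + m%:R != 0) ->
  [\/ k = - n.+1%:R, - mu = - n.+1%:R, s - k = - n%:R | s + mu = - n%:R] ->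
  rational_on (dom1 k mu s) (y1 k mu s).
Proof.
move=> s0 H.
have [|p [q E]] := hypergeo_ratio_rational Kc Ka (a := k) (b := - mu) (n := n) s0.
  by rewrite opprK.
exists ('X * (q + (mu / s) *: p)), q => x /E[q0 r]; split => //.
rewrite y1E r hornerM hornerD hornerZ hornerX; field.
by rewrite q0 shift0_neq0.
Qed.

Lemma y2_rational k mu s (n : nat) : (forall m : nat, 2 - s + m%:R != 0) -> k != 0 ->
  [\/ k - s + 1 = - n.+1%:R, 1 - mu - s = - n.+1%:R, 1 - k = - n%:R | 1 + mu = - n%:R] ->
  rational_on (dom2 k mu s) (y2 k mu s).
Proof.
move=> s0 k0 H.
have [|p [q E]] := hypergeo_ratio_rational Kc Ka
   (a := k - s + 1) (b := 1 - mu - s) (n := n) s0.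
  (* These are [c - a] and [c - b] for the parameters of the second solution. *)
  have -> : 2 - s - (k - s + 1) = 1 - k by ring.
  by have -> : 2 - s - (1 - mu - s) = 1 + mu by ring.
exists ((('X - 1) * (1 - s)%:P + k *: 'X) * q
    - ((k - s + 1) * (1 - mu - s) / (2 - s)) *: ('X * p)), (k *: q) => x Dx.
have [q0 r] := E x Dx; have [x0 x1 _] := hypergeo_domain_open Kc Ka s0 Dx.
rewrite hornerZ mulf_neq0 //; split => //.
rewrite y2E // /y2_num r hornerD hornerN hornerM !hornerZ hornerM !hornerD hornerZ.
rewrite hornerM hornerD hornerN !hornerC hornerX; field.
by rewrite q0 k0 shift0_neq0.
Qed.

End NonDegenerate.

(** * The complex numbers: archimedean bound and convergence of geometrically dominated series *)

Section Complex.
Context {R : realType}.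
Implicit Types (x : R[i]).

(** Multiplication by ['i] preserves the norm and turns the imaginary part into a real part, up to
    sign. *)
Lemma normc_ge_Im x : `|complex.Im x|%:C%C <= `|x|.
Proof.
have := normc_ge_Re (x * 'i%C); rewrite ReiNIm normrN normrM.
have -> : `|'i%C : R[i]| = 1 by rewrite normc_def /= expr0n expr1n add0r sqrtr1.
by rewrite mulr1.
Qed.

Lemma normc_le_ReIm x : `|x| <= `|complex.Re x|%:C%C + `|complex.Im x|%:C%C.
Proof.
have nR (r : R) : `|r%:C%C : R[i]| = `|r|%:C%C.
  by rewrite normc_def /= expr0n addr0 sqrtr_sqr.
rewrite {1}(complexE x); apply: le_trans (ler_normD _ _) _.
rewrite normrM; have -> : `|'i%C : R[i]| = 1 by rewrite normc_def /= expr0n expr1n add0r sqrtr1.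
by rewrite mul1r !nR.
Qed.

Lemma archimedean_complex : archimedean R[i].
Proof.
move=> x; have [r rE] : exists r : R, `|x| = r%:C%C by exists (complex.Re `|x|); rewrite RRe_real.
have r0 : 0 <= r by rewrite -ler0c -rE.
exists (Num.bound r); rewrite rE -(rmorph_nat (real_complex R)) lecR.
by apply: ltW; apply: archi_boundP.
Qed.

Lemma is_cvg_series_of_geometric (v : nat -> R) (C q : R) : 0 <= q < 1 ->
  (forall n, `|v n| <= C * q ^+ n) -> cvgn (series v).
Proof.
move=> /andP[q0 q1] H; apply: normed_cvg.
have C0 : 0 <= C by have := H 0%N; rewrite mulr1; apply: le_trans.
apply: (@series_le_cvg _ _ (geometric C q)) => [n|n|n|].
- exact: normr_ge0.
- by rewrite mulr_ge0 // exprn_ge0.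
- exact: H.
by apply: is_cvg_geometric_series; rewrite ger0_norm.
Qed.

Lemma cvg_complex (u : nat -> (R[i] : numFieldType)) (a b : R) :
  complex.Re (u n) @[n --> \oo] --> a -> complex.Im (u n) @[n --> \oo] --> b ->
  u n @[n --> \oo] --> ((a +i* b)%C : (R[i] : numFieldType)).
Proof.
move=> /cvgrPdist_lt Ha /cvgrPdist_lt Hb; apply/cvgrPdist_lt => e e0.
have [r rE] : exists r : R, e = r%:C%C.
  by exists (complex.Re e); rewrite RRe_real // gtr0_real.
have r0 : 0 < r by rewrite -ltcR -rE.
have r20 : 0 < r / 2 by rewrite divr_gt0.
near=> n; apply: le_lt_trans (normc_le_ReIm _) _.
rewrite rE -rmorphD ltcR [ltRHS]splitr !raddfB /=.
by apply: ltrD; near: n; [exact: Ha | exact: Hb].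
Unshelve. all: by end_near. Qed.

(** Real and imaginary parts are dominated by the same real geometric sequence, so each series
    converges absolutely in [R]. *)
Lemma geometric_complete_complex : geometric_complete R[i].
Proof.
move=> u C q /andP[q0 q1] H.
have C0 : 0 <= C by have := H 0%N; rewrite mulr1; apply: le_trans.
(* A nonnegative element of [R[i]] is real, so [q] and [C] descend to [R]. *)
have qE := RRe_real (ger0_real q0); have CE := RRe_real (ger0_real C0).
set q' := complex.Re q in qE; set C' := complex.Re C in CE.
have q01 : 0 <= q' < 1 by rewrite -ler0c -ltcR qE q0.
have H' n : `|u n| <= (C' * q' ^+ n)%:C%C by rewrite rmorphM rmorphXn /= qE CE.
have cRe : cvgn (series (fun n => complex.Re (u n))).
  apply: (is_cvg_series_of_geometric (C := C') q01) => n.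
  by rewrite -lecR; apply: le_trans (normc_ge_Re _) (H' n).
have cIm : cvgn (series (fun n => complex.Im (u n))).
  apply: (is_cvg_series_of_geometric (C := C') q01) => n.
  by rewrite -lecR; apply: le_trans (normc_ge_Im _) (H' n).
move: cRe cIm => /cvg_ex[a Ha] /cvg_ex[b Hb]; apply/cvg_ex; exists (a +i* b)%C.
apply: cvg_complex.
  have -> : (fun n => complex.Re (series u n)) = series (fun n => complex.Re (u n)) => //.
  by apply/funext => n; rewrite /series /= raddf_sum.
have -> : (fun n => complex.Im (series u n)) = series (fun n => complex.Im (u n)) => //.
by apply/funext => n; rewrite /series /= raddf_sum.
Qed.

End Complex.
Theorem mainTheorem1 (R : realType) (k mu s : R[i]) :
  ((forall n : nat, s != - n%:R) ->
    [/\ PVI_solution_on (dom1 k mu s)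
          (k ^+ 2 / 2) (- (mu + s) ^+ 2 / 2) ((k - s + 1) ^+ 2 / 2)
          ((1 - mu ^+ 2) / 2) (y1 k mu s),
        mu != 0 -> mu + s != 0 ->
          PVI_nondegenerate_on (dom1 k mu s) (y1 k mu s) &
        [\/ positive_integer mu, negative_integer k,
            positive_integer (k - s) | negative_integer (mu + s)] ->
          rational_on (dom1 k mu s) (y1 k mu s)])
  /\
  ((forall n : int, s != n%:~R) -> k != 0 ->
    [/\ PVI_solution_on (dom2 k mu s)
          (k ^+ 2 / 2) (- (mu + s) ^+ 2 / 2) ((k - s + 1) ^+ 2 / 2)
          ((1 - mu ^+ 2) / 2) (y2 k mu s),
        k - s + 1 != 0 ->
          PVI_nondegenerate_on (dom2 k mu s) (y2 k mu s),
        exists x : R[i],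
          [/\ dom1 k mu s x, dom2 k mu s x & y2 k mu s x != y1 k mu s x] &
        [\/ negative_integer (1 - mu - s), negative_integer (k - s + 1),
            positive_integer k | negative_integer mu] ->
          rational_on (dom2 k mu s) (y2 k mu s)]).
Proof.
have Kc := @geometric_complete_complex R; have Ka := @archimedean_complex R.
split => [s_neg | s_int k0].
  have s0 (m : nat) : s + m%:R != 0 by rewrite addr_eq0 s_neg.
  split; first 2 last.
  - case=> -[n E].
    + by apply: (y1_rational Kc Ka (n := n)) => //; constructor 2; rewrite E.
    + by apply: (y1_rational Kc Ka (n := n)) => //; constructor 1.
    (* Here [s - k] is [- (n + 1)], while the last two cases of [y1_rational] are indexed from 0;
       hence [n.+1]. *)
    + by apply: (y1_rational Kc Ka (n := n.+1)) => //; constructor 3; rewrite -opprB E.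
    + by apply: (y1_rational Kc Ka (n := n.+1)) => //; constructor 4; rewrite addrC.
  - apply: riccati_PVI_solution => x Dx; last exact: y1_riccati.
    exact: hypergeo_domain_open.
  - exact: y1_nondegenerate.
have s0 (m : nat) : s + m%:R != 0.
  by rewrite addr_eq0; have := s_int (- m%:Z); rewrite rmorphN.
(* Otherwise [s] would be the integer [2 + m]. *)
have s20 (m : nat) : 2 - s + m%:R != 0.
  rewrite addrAC subr_eq0 -natrD eq_sym; exact: (s_int (2 + m)%N).
have s1 : s != 1 by exact: (s_int 1).
split; first 3 last.
- case=> -[n E].
  + by apply: (y2_rational Kc Ka (n := n)) => //; constructor 2.
  + by apply: (y2_rational Kc Ka (n := n)) => //; constructor 1.
  (* With [k = n + 1] the relevant parameter is [1 - k = - n], so the index does not shift. *)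
  + apply: (y2_rational Kc Ka (n := n)) => //; constructor 3.
    by rewrite E -natr1 opprD addrCA subrr addr0.
  + apply: (y2_rational Kc Ka (n := n)) => //; constructor 4.
    by rewrite E -natr1 opprD addrCA subrr addr0.
- apply: riccati_PVI_solution => x Dx; last exact: y2_riccati.
  exact: hypergeo_domain_open.
- exact: y2_nondegenerate.
- exact: y1_neq_y2.
Qed.
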